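(* Let $X$ be a subshift with word complexity sequence $c_n(X)$ such that $$\frac{c_n(X)}{n^{2} (\log n)^{-1}} \to 0 \quad \text{as } n\to\infty.$$ Then the automorphism group $\mathrm{Aut}(X,\sigma)$ is amenable (and countable).
   Context: Let $\mathcal{A}$ be a finite alphabet. The full shift $\mathcal{A}^{\mathbb{Z}}$ carries the product topology of the discrete topology, and the left shift $\sigma$ is defined by $(\sigma x)(n) = x(n+1)$. A subshift over $\mathcal{A}$ is a closed subset $X \subset \mathcal{A}^{\mathbb{Z}}$ invariant under $\sigma$ (i.e. $\sigma(X)=X$). The language $L(X)$ is the set of all finite words occurring as subwords (blocks of consecutive letters) of points of $X$; $L_n(X) = L(X)\cap \mathcal{A}^n$; and $c_n(X) = |L_n(X)|$. An automorphism of $X$ is a homeomorphism $\phi: X \to X$ with $\phi\circ\sigma = \sigma\circ\phi$; these form a group $\mathrm{Aut}(X,\sigma)$ under composition. Groups are regarded as discrete. A countable group $G$ is amenable if there is a sequence of finite (nonempty) subsets $F_i \subset G$ such that $\lim_{i\to\infty} |F_i \,\Delta\, gF_i|/|F_i| = 0$ for every $g \in G$. *)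

(* Defs.v *)
From HB Require Import structures.
From mathcomp Require Import all_boot all_order all_algebra.
From mathcomp Require Import finmap.
From mathcomp Require Import all_classical all_reals all_analysis.

Set Implicit Arguments.
Unset Strict Implicit.
Unset Printing Implicit Defensive.

Import Order.TTheory GRing.Theory Num.Theory.
Import numFieldNormedType.Exports.

Local Open Scope classical_set_scope.
Local Open Scope ring_scope.

Definition full_shift (A : finType) : topologicalType :=
  {ptws int -> discrete_topology A}.

Definition left_shift (A : finType) (x : full_shift A) : full_shift A :=
  fun n : int => x (n + 1).

Record subshift (A : finType) := Subshift {
  subshift_set :> set (full_shift A);
  subshift_closed : closed subshift_set;
  subshift_shift : [set left_shift x | x in subshift_set] = subshift_set
}.

Definition language (A : finType) (X : subshift A) : set (seq A) :=
  [set w | exists2 x, subshift_set X x &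
     exists (m : int) (n : nat), w = mkseq (fun i : nat => x (m + i%:Z)) n].

Definition language_n (A : finType) (X : subshift A) (n : nat) :
    {set n.-tuple A} :=
  [set w : n.-tuple A | `[< language X w >]]%SET.

Definition complexity (A : finType) (X : subshift A) (n : nat) : nat :=
  #|language_n X n|.

Section Automorphisms.
Variables (A : finType) (X : subshift A).

(* Below, [X] used as a type is [set_type X], with the subspace
   topology (the initial topology of the inclusion). *)

Lemma shift_mem (x : X) : left_shift (set_val x) \in (X : set (full_shift A)).
Proof.
by apply/mem_set; rewrite -[X in X _]subshift_shift; exists (set_val x) => //;
exact: set_valP.
Qed.

Definition subshift_map (x : X) : X := exist _ (left_shift (set_val x)) (shift_mem x).

Definition homeomorphism (T U : topologicalType) (f : T -> U) :=
  continuous f /\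
  exists g : U -> T, [/\ continuous g, cancel f g & cancel g f].

Definition is_automorphism : set (X -> X) :=
  [set phi | homeomorphism phi /\ phi \o subshift_map = subshift_map \o phi].

Definition Aut : Type := is_automorphism.
HB.instance Definition _ := Choice.on Aut.

Lemma is_automorphism_id : is_automorphism id.
Proof. by split=> //; split; [|exists id; split] => // x; exact: cvg_id. Qed.

Lemma is_automorphism_comp (f g : X -> X) :
  is_automorphism f -> is_automorphism g -> is_automorphism (f \o g).
Proof.
move=> [[cf [f' [cf' ff' f'f]]] fS] [[cg [g' [cg' gg' g'g]]] gS].
split; last by rewrite -compA gS compA fS.
split; first by move=> x; apply: continuous_comp; [exact: cg|exact: cf].
exists (g' \o f'); split.
- by move=> x; apply: continuous_comp; [exact: cf'|exact: cg'].
- by move=> x /=; rewrite ff' gg'.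
- by move=> x /=; rewrite g'g f'f.
Qed.

Lemma is_automorphism_inv (f : X -> X) : is_automorphism f ->
  exists g, [/\ is_automorphism g, cancel f g & cancel g f].
Proof.
move=> [[cf [g [cg fg gf]]] fS]; exists g; split=> //; split.
  by split=> //; exists f.
apply/funext => x /=; apply: (can_inj fg); rewrite gf.
by have /= -> := congr1 (@^~ (g x)) fS; rewrite gf.
Qed.

Definition Aut_one : Aut := exist _ id (mem_set is_automorphism_id).

Definition Aut_mul (f g : Aut) : Aut :=
  exist _ (set_val f \o set_val g)
    (mem_set (is_automorphism_comp (set_valP f) (set_valP g))).

Definition Aut_inv (f : Aut) : Aut :=
  let g := cid (is_automorphism_inv (set_valP f)) in
  exist _ (projT1 g) (mem_set (let: And3 autg _ _ := projT2 g in autg)).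

Lemma Aut_mulA : associative Aut_mul.
Proof. by move=> f g h; exact/val_inj. Qed.

Lemma Aut_mul1 : left_id Aut_one Aut_mul.
Proof. by move=> f; exact/val_inj. Qed.

Lemma Aut_mulr1 : right_id Aut_one Aut_mul.
Proof. by move=> f; exact/val_inj. Qed.

Lemma Aut_mulV : left_inverse Aut_one Aut_inv Aut_mul.
Proof.
move=> f; apply/val_inj/funext => x; rewrite /= /Aut_inv.
by case: (cid (is_automorphism_inv (set_valP f))) => g [? fg gf]; exact: fg.
Qed.

Lemma Aut_mulrV : right_inverse Aut_one Aut_inv Aut_mul.
Proof.
move=> f; apply/val_inj/funext => x; rewrite /= /Aut_inv.
by case: (cid (is_automorphism_inv (set_valP f))) => g [? fg gf]; exact: gf.
Qed.

HB.instance Definition _ := isGroup.Build Aut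
  Aut_mulA Aut_mul1 Aut_mulr1 Aut_mulV Aut_mulrV.

End Automorphisms.

Definition fset_symdiff (K : choiceType) (E F : {fset K}) : {fset K} :=
  ((E `\` F) `|` (F `\` E))%fset.

(* [R] is only the field in which the limit of the ratios is taken. *)
Definition amenable (R : realType) (G : groupType) : Prop :=
  exists F : nat -> {fset G},
    (forall i, F i != fset0) /\
    forall g : G,
      (#|` fset_symdiff (F i) [fset (g * h)%g | h in F i]%fset|%:R
         / #|` F i|%:R : R) @[i --> \oo] --> (0 : R).

(* Main.v *)
(* Write c for the complexity and let L_N be the set of words of length N.
   Fix on L_N a default successor s.  The words of length N + 1 that do not
   follow s number at most c(N+1) - c(N), and reading a point back to its last
   non-default step, or, when there is none among c(N) steps, around a cycle of
   s, shows that L_N is covered by windows of length about c(N) of at most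
     M = c(N+1) - c(N) + #(cycles of s)
   points.  An automorphism of range n with 2n < N is determined by its values
   on these windows, so there are at most c(c(N) + 1)^M of them.
   A cycle of length p consists of words of period p, and such words are
   determined by a prefix of length 2p; a dyadic summation then shows that the
   number of cycles is o(N / log N).  For a suitable N between 2^J and 2^(J+1)
   the increment c(N+1) - c(N) is o(N / log N) as well, and log c(c(N) + 1) is
   O(log N), so the automorphisms of range n number exp(o(n)) for infinitely
   many n.  Hence finitely generated submonoids have subexponential growth and
   their balls contain Folner sets. *)
Require Import Defs.
From mathcomp Require Import all_boot all_order all_algebra finmap.
From mathcomp Require Import all_classical all_reals all_analysis.
From mathcomp Require Import zify ring lra.

Set Implicit Arguments.
Unset Strict Implicit.
Unset Printing Implicit Defensive.

Import Order.TTheory GRing.Theory Num.Theory numFieldNormedType.Exports.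
Local Open Scope classical_set_scope.
Local Open Scope ring_scope.

(** * Cylinder neighbourhoods and the range of a continuous map *)

Definition agree (A : finType) (n : nat) (x y : full_shift A) : Prop :=
  forall i : int, (`|i| <= n)%N -> x i = y i.

Lemma nbhs_agree (A : finType) (x : full_shift A) (U : set (full_shift A)) :
  nbhs x U <-> exists n, agree n x `<=` U.
Proof.
pose F : set_system (full_shift A) := filter_from [set: nat] (fun n => agree n x).
have FF : Filter F.
  apply: filter_from_filter; first by exists 0%N.
  move=> m n _ _; exists (maxn m n) => // y xy; split=> i ile; apply: xy.
    by rewrite leq_max ile.
  by rewrite leq_max ile orbT.
split=> [xU|[n xU]].
  suff : F U by move=> [n _ ?]; exists n.
  suff : F --> x by apply.
  (* The product topology is the supremum of those induced by single coordinates; for coordinate [i]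
     the radius [|i|] suffices. *)
  apply/(@cvg_sup (int -> A) int) => i V [B [[C oC CB] Bx] BV].
  exists `|i|%N => // y /(_ i (leqnn _)) xy; apply: BV; rewrite -CB /=.
  by move: Bx; rewrite -CB /= xy.
have one (i : int) : nbhs x [set y : full_shift A | x i = y i].
  have ci : {for x, continuous (fun y : full_shift A => y i : discrete_topology A)}.
    exact: (@proj_continuous int (fun=> discrete_topology A) i).
  have xi : nbhs (x i : discrete_topology A) [set a | x i = a].
    exact: (@filterS _ _ _ [set x i] _ (fun a => esym) (discrete_set1 _)).
  exact: (ci _ xi).
have all_le m : nbhs x (agree m x).
  elim: m => [|m IHm].
    by apply: filterS (one 0) => y ? i; rewrite leqn0 absz_eq0 => /eqP ->.
  apply: filterS (filterI IHm (filterI (one m.+1) (one (- m.+1%:Z)))).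
  move=> y [xy [/= xym xyNm]] i; rewrite leq_eqVlt => /orP[/eqP|]; last exact: xy.
  by case: i => k /= k_m; [move: xym | move: xyNm]; rewrite -k_m // NegzE.
by apply: filterS (all_le n).
Qed.

Lemma subshift_compact (A : finType) (X : subshift A) :
  compact (X : set (full_shift A)).
Proof.
apply: (subclosed_compact (@subshift_closed _ X)
  (@tychonoff int (fun=> discrete_topology A) (fun=> setT) _)); last by [].
by move=> _; apply: finite_compact; exact: finite_finset.
Qed.

Definition has_range (A : finType) (X : subshift A) (n : nat) (f : X -> X) : Prop :=
  forall x y : X, agree n (set_val x) (set_val y) ->
    set_val (f x) 0 = set_val (f y) 0.

(** The Curtis-Hedlund-Lyndon argument: near each point some radius works, and compactness, as
    near-covering along [\oo], makes the radius uniform. *)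
Lemma continuous_has_range (A : finType) (X : subshift A) (f : X -> X) :
  continuous f -> exists n, has_range n f.
Proof.
move=> cf.
pose P (n : nat) (x : full_shift A) := forall x' y' : X, set_val x' = x ->
  agree n x (set_val y') -> set_val (f x') 0 = set_val (f y') 0.
have /compact_near_coveringP := @subshift_compact A X.
move=> /(_ nat \oo P); case=> [x Xx|n _ Pn]; last first.
  exists n => x y; apply: (Pn n (leqnn n) (set_val x)) => //.
  exact: set_valP.
pose x' : X := exist _ x (mem_set Xx).
have [n xn] : exists n, forall y : X, agree n x (set_val y) ->
    set_val (f x') 0 = set_val (f y) 0.
  have : nbhs (f x') [set z : X | set_val (f x') 0 = set_val z 0].
    exists [set z : X | set_val (f x') 0 = set_val z 0]; split=> //.
    exists [set z : full_shift A | set_val (f x') 0 = z 0] => //.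
    rewrite openE => z /= xz; apply/nbhs_agree.
    by exists 0%N => w zw; rewrite /= xz zw.
  move=> /cf [B [[C oC <-] Cx] BP].
  have /nbhs_agree[n xC] : nbhs x C by apply: open_nbhs_nbhs.
  by exists n => y xy; apply: BP; apply: xC.
exists (agree n x, [set m | (n <= m)%N]) => /=.
  by split; [apply/nbhs_agree; exists n | exists n].
case=> y m [/= xy nm] y' z' y'E yz.
rewrite -(xn y') ?y'E//; apply: xn => i ile.
by rewrite xy// yz// (leq_trans ile).
Qed.


(** * Words, shifts by integers and the language *)

Definition word (A : finType) (X : subshift A) (x : X) (m : int) (n : nat) :
  n.-tuple A := [tuple set_val x (m + i%:Z) | i < n].

Lemma tnth_word (A : finType) (X : subshift A) (x : X) m n (i : 'I_n) :
  tnth (word x m n) i = set_val x (m + i%:Z).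
Proof. by rewrite tnth_mktuple. Qed.

Lemma word_eqP (A : finType) (X : subshift A) (x y : X) (m m' : int) n :
  word x m n = word y m' n <->
  forall k : nat, (k < n)%N -> set_val x (m + k%:Z) = set_val y (m' + k%:Z).
Proof.
split=> [xy k kn|xy]; last by apply/eq_from_tnth => i; rewrite !tnth_word xy.
by have := congr1 (fun w => tnth w (Ordinal kn)) xy; rewrite !tnth_word.
Qed.

(** A relation instead of a function: for negative [m] the shifted point is only obtained from the
    surjectivity of the shift on [X]. *)
Definition shifted (A : finType) (X : subshift A) (m : int) (x y : X) : Prop :=
  forall i : int, set_val y i = set_val x (i + m).

Lemma shifted_exists (A : finType) (X : subshift A) (m : int) (x : X) :
  exists y : X, shifted m x y.
Proof.
have pos (n : nat) (z : X) : exists y : X, shifted n z y.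
  elim: n z => [|n IHn] z; first by exists z => i; rewrite addr0.
  have [y zy] := IHn z; exists (subshift_map y) => i.
  rewrite [LHS]zy; congr (set_val z _); lia.
have neg (n : nat) (z : X) : exists y : X, shifted (- n%:Z) z y.
  elim: n z => [|n IHn] z; first by exists z => i; rewrite oppr0 addr0.
  have [y zy] := IHn z.
  have : subshift_set X (set_val y) by exact: set_valP.
  rewrite -[X in X _]subshift_shift => -[u Xu uy].
  exists (exist _ u (mem_set Xu)) => i.
  change (u i = set_val z (i + - n.+1%:Z)).
  have -> : u i = left_shift u (i - 1) by rewrite /left_shift subrK.
  rewrite uy zy; congr (set_val z _); lia.
by case: (intP m) => [|n|n]; [exact: (pos 0%N) | exact: pos | exact: neg].
Qed.

Lemma shifted_commute (A : finType) (X : subshift A) (f : X -> X)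
    (m : int) (x y : X) :
  f \o @subshift_map A X = @subshift_map A X \o f -> shifted m x y ->
  shifted m (f x) (f y).
Proof.
move=> fS.
have fSE z : f (subshift_map z) = subshift_map (f z) := congr1 (@^~ z) fS.
have iterE n (z : X) i :
    set_val (iter n (@subshift_map A X) z) i = set_val z (i + n%:Z).
  elim: n i => [|n IHn] i; first by rewrite addr0.
  transitivity (set_val (iter n (@subshift_map A X) z) (i + 1)) => //.
    by rewrite IHn; congr (set_val z _); lia.
have fiter n z : f (iter n (@subshift_map A X) z) = iter n (@subshift_map A X) (f z).
  by elim: n => //= n IHn; rewrite fSE IHn.
have pos (n : nat) (u v : X) : shifted n u v -> shifted n (f u) (f v).
  move=> uv; have -> : v = iter n (@subshift_map A X) u.
    by apply/val_inj/funext => i; rewrite [RHS]iterE; exact: uv.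
  by move=> i; rewrite fiter iterE.
case: (intP m) => [|n|n] xy; [exact: (pos 0%N) | exact: pos |].
have yx : shifted n.+1 y x by move=> i; rewrite xy; congr (set_val x _); lia.
move=> i; rewrite (pos _ _ _ yx); congr (set_val (f y) _); lia.
Qed.

Lemma word_shifted (A : finType) (X : subshift A) (m k : int) n (x y : X) :
  shifted m x y -> word y k n = word x (k + m) n.
Proof.
move=> xy; apply/word_eqP => i _; rewrite xy; congr (set_val x _); lia.
Qed.

Lemma word_language (A : finType) (X : subshift A) (x : X) m n :
  word x m n \in language_n X n.
Proof.
rewrite inE; apply/asboolP; exists (set_val x); first exact: set_valP.
exists m, n; rewrite /word /= /mkseq -val_enum_ord -map_comp.
by apply: eq_map => i.
Qed.

Lemma language_nP (A : finType) (X : subshift A) n (w : n.-tuple A) (m : int) :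
  w \in language_n X n -> exists x : X, w = word x m n.
Proof.
rewrite inE => /asboolP[u Xu [k [n' wE]]].
have n'E : n' = n by have := congr1 size wE; rewrite size_tuple size_mkseq.
move: wE; rewrite {}n'E => wE.
have [y xy] := shifted_exists (k - m) (exist _ u (mem_set Xu) : X).
exists y; rewrite (word_shifted _ _ xy); apply/val_inj; rewrite [LHS]wE /=.
rewrite /mkseq -val_enum_ord -map_comp; apply: eq_map => i /=.
congr (u _); lia.
Qed.

Definition wprefix (A : finType) m n (mn : (m <= n)%N) (w : n.-tuple A) :
  m.-tuple A := [tuple tnth w (widen_ord mn i) | i < m].

Lemma wprefix_word (A : finType) (X : subshift A) m n (mn : (m <= n)%N)
    (x : X) k : wprefix mn (word x k n) = word x k m.
Proof. by apply/eq_from_tnth => i; rewrite !tnth_mktuple. Qed.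

Lemma leq_complexity (A : finType) (X : subshift A) m n :
  (m <= n)%N -> (complexity X m <= complexity X n)%N.
Proof.
move=> mn; rewrite /complexity.
apply: leq_trans (leq_imset_card (wprefix mn) (language_n X n)).
apply/subset_leq_card/fintype.subsetP => w /(language_nP 0)[x ->].
by apply/imsetP; exists (word x 0 n); rewrite ?word_language ?wprefix_word.
Qed.


(** * Default successors and the covering of the language *)

Lemma iter_modn (T : Type) (f : T -> T) p m (x : T) :
  iter p f x = x -> iter m f x = iter (m %% p) f x.
Proof.
move=> fx; rewrite {1}(divn_eq m p) addnC iterD; congr (iter _ f _).
by rewrite iterM iter_fix.
Qed.

Definition wbehead (A : finType) n (w : n.+1.-tuple A) : n.-tuple A :=
  [tuple tnth w (lift ord0 i) | i < n].

Lemma wbehead_word (A : finType) (X : subshift A) (x : X) k n :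
  wbehead (word x k n.+1) = word x (k + 1) n.
Proof.
apply/eq_from_tnth => i; rewrite !tnth_mktuple; congr (set_val x _).
rewrite /= /bump /=; lia.
Qed.

Definition successor (A : finType) (X : subshift A) N
    (s : N.-tuple A -> N.-tuple A) : Prop :=
  forall w, w \in language_n X N ->
    exists x : X, w = word x 0 N /\ s w = word x 1 N.

Lemma successor_exists (A : finType) (X : subshift A) N :
  exists s : N.-tuple A -> N.-tuple A, successor X s.
Proof.
have /choice[s sP] : forall w : N.-tuple A, exists w', w \in language_n X N ->
    exists x : X, w = word x 0 N /\ w' = word x 1 N.
  move=> w; case: (boolP (w \in language_n X N)) => [/(language_nP 0)[x ->]|_].
    by exists (word x 1 N) => _; exists x.
  by exists w.
by exists s.
Qed.

(** A word of length [N.+1] is an edge of the Rauzy graph, from its prefix to its suffix; these are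
    the edges outside the graph of [s]. *)
Definition nondefault (A : finType) (X : subshift A) N
    (s : N.-tuple A -> N.-tuple A) : {set N.+1.-tuple A} :=
  [set e in language_n X N.+1 | wbehead e != s (wprefix (leqnSn N) e)].

(** Every word of length [N] is the prefix of a default edge, so there are at least [complexity X N]
    default edges. *)
Lemma card_nondefault (A : finType) (X : subshift A) N
    (s : N.-tuple A -> N.-tuple A) : successor X s ->
  (#|nondefault X s| + complexity X N <= complexity X N.+1)%N.
Proof.
move=> sP; rewrite [leqRHS]/complexity -(cardsID (nondefault X s) (language_n X N.+1)).
have /finset.setIidPr -> : nondefault X s \subset language_n X N.+1.
  by apply/fintype.subsetP => e; rewrite inE => /andP[].
rewrite leq_add2l.
apply: leq_trans (leq_imset_card (wprefix (leqnSn N)) _).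
apply/subset_leq_card/fintype.subsetP => w /[dup] wL /sP[x [wE swE]].
apply/imsetP; exists (word x 0 N.+1); last by rewrite wprefix_word.
by rewrite 2!inE word_language wprefix_word wbehead_word -wE swE eqxx.
Qed.

Definition cycle_of (T : finType) (s : T -> T) (w : T) : {set T} :=
  [set u | fconnect s w u].

Definition cyclic_words (A : finType) (X : subshift A) N
    (s : N.-tuple A -> N.-tuple A) : {set N.-tuple A} :=
  [set w in language_n X N | fconnect s (s w) w].

Definition word_cycles (A : finType) (X : subshift A) N
    (s : N.-tuple A -> N.-tuple A) : {set {set N.-tuple A}} :=
  [set cycle_of s w | w in cyclic_words X s].

Definition default_step (A : finType) (X : subshift A) N
    (s : N.-tuple A -> N.-tuple A) (x : X) (i : int) : bool :=
  word x (i + 1) N == s (word x i N).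

Lemma word_default_steps (A : finType) (X : subshift A) N
    (s : N.-tuple A -> N.-tuple A) (x : X) (m : int) (k : nat) :
  (forall i : nat, (i < k)%N -> default_step s x (m + i%:Z)) ->
  word x (m + k%:Z) N = iter k s (word x m N).
Proof.
elim: k => [|k IHk] st; first by rewrite addr0.
rewrite iterS -IHk => [|i ik]; last by apply: st; lia.
by rewrite -(eqP (st k (ltnSn k))); congr (word x _ N); lia.
Qed.

Lemma cycle_of_eq (T : finType) (s : T -> T) (w u : T) :
  fconnect s (s w) w -> u \in cycle_of s w -> cycle_of s u = cycle_of s w.
Proof.
move=> sw; rewrite inE => wu.
suff uw : fconnect s u w.
  apply/finset.setP => z; rewrite !inE; apply/idP/idP; exact: connect_trans.
have [p pw] : exists k, iter k.+1 s w = w by apply/(orbitPcycle 2 3).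
have [m um] : exists m, u = iter m s w by exists (findex s w u); rewrite iter_findex.
rewrite um (iter_modn m pw).
have /ltnW mp : (m %% p.+1 < p.+1)%N by rewrite ltn_mod.
have {2}-> : w = iter (p.+1 - m %% p.+1) s (iter (m %% p.+1) s w).
  by rewrite -iterD subnK.
exact: fconnect_iter.
Qed.

(** Pigeonhole: two of the [v.+1] words at positions 0 to [v] coincide, so the walk has entered a
    cycle, and a full turn around it is seen before position [v]. *)
Lemma default_walk_cycle (A : finType) (X : subshift A) N
    (s : N.-tuple A -> N.-tuple A) (x : X) (v := complexity X N) :
  (forall i : nat, (i < v)%N -> default_step s x i) ->
  word x v N \in cyclic_words X s /\
  forall w, w \in cycle_of s (word x v N) ->
    exists2 j : nat, (j < v)%N & w = word x j N.
Proof.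
move=> st.
have wE k : (k <= v)%N -> word x k N = iter k s (word x 0 N).
  move=> kv; rewrite -[Posz k]add0r (word_default_steps (s := s))// => i ik.
  by rewrite add0r st// (leq_trans ik).
have /trajectP[i iv vi] : looping s (word x 0 N) v.
  apply/negPn; rewrite -looping_uniq; apply/negP => /card_uniqP.
  rewrite size_traject => tE; suff : (v.+1 <= v)%N by rewrite ltnn.
  rewrite -tE.
  apply/subset_leq_card/fintype.subsetP => w /trajectP[k kv ->].
  by rewrite -wE// word_language.
have per : iter (v - i) s (word x v N) = word x v N.
  by rewrite {1}wE// vi -iterD subnK ?(ltnW iv)// wE.
split.
  rewrite inE word_language /=; apply/(orbitPcycle 3 2).
  by exists (v - i).-1; rewrite prednK ?subn_gt0.
move=> w; rewrite inE => /iter_findex <-.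
rewrite (iter_modn _ per); set m := (_ %% _)%N.
have mvi : (m < v - i)%N by rewrite ltn_mod subn_gt0.
exists (m + i)%N; first by rewrite addnC -ltn_subRL.
by rewrite (wE v)// vi -iterD -wE//; lia.
Qed.

(** Place a word at position [v] of a point and read back to position 0. After the last non-default
    edge the walk is forced by that edge and the number of default steps; without such an edge the
    word lies on a cycle of [s]. One point per edge and one per cycle suffice. *)
Lemma language_cover (A : finType) (X : subshift A) N
    (s : N.-tuple A -> N.-tuple A) : successor X s ->
  exists ys : seq X,
    (size ys + complexity X N <= complexity X N.+1 + #|word_cycles X s|)%N /\
    forall w, w \in language_n X N -> exists2 y, y \in ys &
      exists2 j : nat, (j <= complexity X N)%N & w = word y j N.
Proof.
move=> sP; set v := complexity X N.
have [[x0 _]|X0] := pselect (exists x : X, True); last first.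
  exists [::]; split; first by rewrite add0n (leq_trans (leq_complexity _ (leqnSn N)))// leq_addr.
  by move=> w /(language_nP 0)[x _]; case: X0; exists x.
pose walk (e : N.+1.-tuple A) (k : nat) (y : X) :=
  word y 0 N.+1 = e /\ forall j : nat, (j < k)%N -> default_step s y (1 + j%:Z).
(* For each edge [e] choose a point that starts with [e] and then follows [s] as long as possible,
   up to [v] steps: it serves all shorter walks too. *)
have /choice[ye yeP] : forall e, exists ye : X, forall y k, (k <= v)%N ->
    walk e k y -> exists2 k', (k <= k' <= v)%N & walk e k' ye.
  move=> e; pose P k := (k <= v)%N && `[< exists y, walk e k y >].
  have [[k0 Pk0]|noP] := pselect (exists k, P k); last first.
    exists x0 => y k kv yk; case: noP; exists k; rewrite /P kv.
    by apply/asboolP; exists y.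
  have Pv k : P k -> (k <= v)%N by case/andP.
  case: (ex_maxnP (ex_intro (fun i => is_true (P i)) _ Pk0) Pv) => k /andP[kv /asboolP[ye yeP]] kmax.
  exists ye => y j jv yj; exists k => //; rewrite kv kmax// /P jv.
  by apply/asboolP; exists y.
pose closing (O : {set N.-tuple A}) (y : X) :=
  (forall i : nat, (i < v)%N -> default_step s y i) /\ cycle_of s (word y v N) = O.
(* Any point that closes on the cycle [O] meets all words of [O], by [default_walk_cycle]. *)
have /choice[yc ycP] : forall O, exists yc, forall y, closing O y -> closing O yc.
  move=> O; have [[y yP]|noy] := pselect (exists y, closing O y); first by exists y.
  by exists x0 => y yP; case: noy; exists y.
exists ([seq ye e | e <- enum (nondefault X s)] ++
        [seq yc B | B <- enum (word_cycles X s)]); split.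
  rewrite size_cat !size_map -!cardE addnAC leq_add2r.
  exact: card_nondefault.
move=> w /(language_nP v)[x xw].
pose P (i : nat) := (i < v)%N && ~~ default_step s x i.
have [[i0 Pi0]|noP] := pselect (exists i, P i); last first.
  have st (i : nat) : (i < v)%N -> default_step s x i.
    by move=> iv; apply/negPn/negP => ni; apply: noP; exists i; rewrite /P iv.
  have [wC _] := default_walk_cycle st.
  have [yst yO] := ycP (cycle_of s w) x (conj st (congr1 _ (esym xw))).
  have [_ /(_ w)[|j jv wj]] := default_walk_cycle yst.
    by rewrite yO inE.
  exists (yc (cycle_of s w)); last by exists j => //; exact: ltnW.
  rewrite mem_cat map_f ?orbT// mem_enum; apply/imsetP; exists w => //.
  by rewrite xw.
have Pv i : P i -> (i <= v)%N by case/andP => /ltnW.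
case: (ex_maxnP (ex_intro (fun i => is_true (P i)) _ Pi0) Pv) => i /andP[iv sti] imax.
have [z xz] := shifted_exists i%:Z x.
(* By maximality of [i], the [v - i.+1] steps after the edge at [i] are default. *)
have zw : walk (word z 0 N.+1) (v - i.+1)%N z.
  split=> // j jv; rewrite /default_step !(word_shifted _ _ xz).
  apply/negPn/negP => stj; have : P (i + j.+1)%N.
    rewrite /P; apply/andP; split; first lia.
    apply: contra stj => /eqP stj; apply/eqP; move: stj.
    have -> : (i + j.+1)%N%:Z = 1 + j%:Z + i%:Z by lia.
    by have -> : 1 + j%:Z + i%:Z + 1 = 1 + j%:Z + 1 + i%:Z by lia.
  by move/imax; lia.
have [k' /andP[kk' kv'] [ye0 yest]] := yeP _ _ _ (leq_subr _ _) zw.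
exists (ye (word z 0 N.+1)).
  rewrite mem_cat map_f// mem_enum inE word_language wprefix_word wbehead_word.
  by rewrite !(word_shifted _ _ xz) add0r addrC.
exists (v - i.+1).+1%N; first lia.
have -> : (v - i.+1).+1%:Z = 1 + (v - i.+1)%N%:Z by lia.
rewrite (word_default_steps (s := s)) => [|j jk]; last by apply: yest; lia.
have -> : word (ye (word z 0 N.+1)) 1 N = word z 1 N.
  by rewrite -[1]add0r -!wbehead_word ye0.
case: zw => _ zst; rewrite -(word_default_steps (s := s)) => [|j jk]; last exact: zst.
by rewrite (word_shifted _ _ xz) xw; congr (word x _ N); lia.
Qed.


(** * Counting the cycles of the successor *)

Lemma in_cycle_of (T : finType) (s : T -> T) (w u : T) :
  (u \in cycle_of s w) = fconnect s w u.
Proof. by rewrite finset.in_set. Qed.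

Lemma successor_language (A : finType) (X : subshift A) N
    (s : N.-tuple A -> N.-tuple A) w k : successor X s ->
  w \in language_n X N -> iter k s w \in language_n X N.
Proof.
move=> sP wL; elim: k => //= k /sP[x [_ ->]]; exact: word_language.
Qed.

(** Each application of [s] drops the first letter and appends one, so the letters move one place to
    the left. *)
Lemma tnth_iter_successor (A : finType) (X : subshift A) N
    (s : N.-tuple A -> N.-tuple A) w k (i j : 'I_N) :
  successor X s -> w \in language_n X N -> j = (i + k)%N :> nat ->
  tnth (iter k s w) i = tnth w j.
Proof.
move=> sP wL; elim: k i => [|k IHk] i ji.
  by congr (tnth w _); apply/val_inj; rewrite /= ji addn0.
have iN : (i.+1 < N)%N by rewrite (leq_trans _ (ltn_ord j))// ji; lia.
rewrite -(IHk (Ordinal iN)); last by rewrite /= ji addnS.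
have [x [wx sx]] := sP _ (successor_language k sP wL).
rewrite iterS sx wx !tnth_word; congr (set_val x _) => /=; lia.
Qed.

Lemma in_cyclic_words (A : finType) (X : subshift A) N
    (s : N.-tuple A -> N.-tuple A) w :
  (w \in cyclic_words X s) = (w \in language_n X N) && fconnect s (s w) w.
Proof. by rewrite finset.in_set. Qed.

Lemma cyclic_words_stable (A : finType) (X : subshift A) N
    (s : N.-tuple A -> N.-tuple A) w u : successor X s ->
  w \in cyclic_words X s -> u \in cycle_of s w -> u \in cyclic_words X s.
Proof.
move=> sP; rewrite !in_cyclic_words in_cycle_of => /andP[wL sw] /iter_findex <-.
rewrite successor_language//=; apply/(orbitPcycle 3 2).
have [p pw] : exists k, iter k.+1 s w = w by apply/(orbitPcycle 2 3).
by exists p; rewrite -iterD addnC iterD pw.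
Qed.

Lemma cyclic_word_period (A : finType) (X : subshift A) N
    (s : N.-tuple A -> N.-tuple A) w (i j : 'I_N) :
  successor X s -> w \in cyclic_words X s ->
  j = (i + #|cycle_of s w|)%N :> nat -> tnth w j = tnth w i.
Proof.
move=> sP; rewrite in_cyclic_words => /andP[wL sw] ji.
rewrite -(tnth_iter_successor sP wL ji).
have -> : #|cycle_of s w| = order s w by apply: eq_card => u; rewrite in_cycle_of.
by congr (tnth _ i); apply/(orbitPcycle 2 4).
Qed.

(* Words w, u with periods p, q <= P and the same prefix of length 2P are equal:
   by induction w_i = w_(i-p) = u_(i-p) = u_(i-p-q) = w_(i-p-q) = w_(i-q)
   = u_(i-q) = u_i for i >= 2P. *)
Lemma card_short_cyclic_words (A : finType) (X : subshift A) N
    (s : N.-tuple A -> N.-tuple A) P : successor X s -> (P + P <= N)%N ->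
  (#|[set w in cyclic_words X s | #|cycle_of s w| <= P]| <= complexity X (P + P))%N.
Proof.
move=> sP PN; set S := [set w in _ | _]%SET.
have in_S w : (w \in S) = (w \in cyclic_words X s) && (#|cycle_of s w| <= P)%N.
  by rewrite finset.in_set.
rewrite -(@card_in_imset _ _ (wprefix PN) S); last first.
  move=> w u; rewrite !in_S => /andP[wc wP] /andP[uc uP] wu.
  have wuE (i : 'I_N) : (i < P + P)%N -> tnth w i = tnth u i.
    move=> iP; have := congr1 (fun t => tnth t (Ordinal iP)) wu.
    rewrite !tnth_mktuple.
    by have -> : widen_ord PN (Ordinal iP) = i by apply/val_inj.
  have card_pos v : (0 < #|cycle_of s v|)%N.
    by apply/card_gt0P; exists v; rewrite in_cycle_of connect0.
  have w0 := card_pos w; have u0 := card_pos u.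
  have wper := cyclic_word_period sP wc; have uper := cyclic_word_period sP uc.
  apply/eq_from_tnth => -[i iN].
  elim/ltn_ind: i iN => i IHi iN.
  have [iP|Pi] := ltnP i (P + P); first exact: wuE.
  set p := #|cycle_of s w| in wP w0 wper; set q := #|cycle_of s u| in uP u0 uper.
  have ipN : (i - p < N)%N by lia.
  have iqN : (i - q < N)%N by lia.
  have ipqN : (i - p - q < N)%N by lia.
  rewrite (wper (Ordinal ipN) (Ordinal iN)) /=; last lia.
  rewrite IHi; last lia.
  rewrite (uper (Ordinal ipqN) (Ordinal ipN)) /=; last lia.
  rewrite -IHi; last lia.
  rewrite -(wper (Ordinal ipqN) (Ordinal iqN)) /=; last lia.
  rewrite IHi; last lia.
  by rewrite -(uper (Ordinal iqN) (Ordinal iN)) //=; lia.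
apply/subset_leq_card/fintype.subsetP => t /imsetP[w wS ->].
move: wS; rewrite in_S in_cyclic_words => /andP[/andP[/(language_nP 0)[x ->] _] _].
by rewrite wprefix_word word_language.
Qed.

(** Distinct cycles are disjoint, and each one counted here has at least [a] words. *)
Lemma card_word_cycles (A : finType) (X : subshift A) N
    (s : N.-tuple A -> N.-tuple A) (Q : pred nat) a : successor X s ->
  (a * #|[set B in word_cycles X s | (a <= #|B|) && Q #|B|]| <=
   #|[set w in cyclic_words X s | Q #|cycle_of s w|]|)%N.
Proof.
move=> sP; set C := [set B in word_cycles X s | _]%SET; set S := [set w in _ | _]%SET.
have in_S w : (w \in S) = (w \in cyclic_words X s) && Q #|cycle_of s w|.
  by rewrite finset.in_set.
have in_C B : (B \in C) = [&& B \in word_cycles X s, (a <= #|B|)%N & Q #|B|].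
  by rewrite finset.in_set.
pose S' := [set w in S | (a <= #|cycle_of s w|)%N]%SET.
have in_S' w : (w \in S') = (w \in S) && (a <= #|cycle_of s w|)%N.
  by rewrite finset.in_set.
have SS' : S' \subset S by apply/fintype.subsetP => w; rewrite in_S' => /andP[].
apply: leq_trans (subset_leq_card SS').
rewrite -[leqRHS]sum1_card (partition_big (cycle_of s) (mem C)) /=; last first.
  move=> w; rewrite in_S' in_S in_C => /andP[/andP[wC ->] ->].
  by rewrite !andbT imset_f.
rewrite mulnC -sum_nat_const; apply: leq_sum => B.
rewrite in_C => /and3P[/imsetP[w wC ->] aw Qw].
rewrite sum1dep_card; apply: leq_trans (aw) _.
apply/subset_leq_card/fintype.subsetP => u uw.
have uE : cycle_of s u = cycle_of s w.
  by apply: cycle_of_eq uw; move: wC; rewrite in_cyclic_words => /andP[].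
by rewrite finset.in_set in_S' in_S uE aw Qw eqxx (cyclic_words_stable sP wC).
Qed.

(** A cycle shorter than [2 ^ j.+1] consists of words determined by a prefix of length [2 ^ j.+2].
    If its length is at least [2 ^ j], it uses up [2 ^ j] of these words, which bounds the cycles in
    one dyadic block. The last bound does the same with all words of length [N]. *)
Lemma word_cycles_dyadic (A : finType) (X : subshift A) N
    (s : N.-tuple A -> N.-tuple A) j (K := fun j =>
      #|[set B in word_cycles X s | #|B| < 2 ^ j]|%N) : successor X s ->
  [/\ ((2 ^ j.+1 <= N) -> (K j <= complexity X (2 ^ j.+1)))%N,
      ((2 ^ j.+2 <= N) ->
        (2 ^ j * K j.+1 <= 2 ^ j * K j + complexity X (2 ^ j.+2)))%N &
      (2 ^ j * #|word_cycles X s| <= 2 ^ j * K j + complexity X N)%N].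
Proof.
move=> sP.
have card_pos v : (0 < #|cycle_of s v|)%N.
  by apply/card_gt0P; exists v; rewrite in_cycle_of connect0.
have split_card (D : {set {set N.-tuple A}}) i :
    (#|D| <= #|[set B in D | #|B| < 2 ^ i]| + #|[set B in D | 2 ^ i <= #|B|]|)%N.
  rewrite -cardsUI; apply: leq_trans (leq_addr _ _).
  apply/subset_leq_card/fintype.subsetP => B BD.
  by rewrite !inE BD /=; case: ltnP.
split.
- move=> jN; rewrite expnS mul2n -addnn in jN *.
  apply: leq_trans (card_short_cyclic_words sP jN).
  rewrite -[leqLHS]mul1n.
  apply: leq_trans (card_word_cycles (fun p => p <= 2 ^ j)%N 1 sP).
  rewrite leq_mul2l/=; apply/subset_leq_card/fintype.subsetP => B.
  rewrite !finset.in_set => /andP[BC /ltnW ->]; rewrite BC andbT /=.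
  by case/imsetP: BC => w _ ->.
- have -> : (2 ^ j.+2 = 2 ^ j.+1 + 2 ^ j.+1)%N by rewrite expnS mul2n addnn.
  move=> jN.
  apply: leq_trans (leq_add (leqnn _) (card_short_cyclic_words sP jN)).
  apply: leq_trans (leq_add (leqnn _)
    (card_word_cycles (fun p => p <= 2 ^ j.+1)%N (2 ^ j) sP)).
  rewrite -mulnDr leq_mul2l; apply/orP; right.
  apply: leq_trans (split_card _ j) _; apply: leq_add;
    apply/subset_leq_card/fintype.subsetP => B; rewrite !finset.in_set.
    by move=> /andP[/andP[-> _] ->].
  by move=> /andP[/andP[-> /ltnW ->] ->].
- apply: leq_trans (_ : _ <= 2 ^ j * K j + #|[set w in cyclic_words X s | true]|)%N _.
    apply: leq_trans (leq_add (leqnn _) (card_word_cycles xpredT (2 ^ j) sP)).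
    rewrite -mulnDr leq_mul2l; apply/orP; right.
    apply: leq_trans (split_card _ j) _; apply: leq_add => //.
    apply/subset_leq_card/fintype.subsetP => B; rewrite !finset.in_set.
    by rewrite andbT.
  rewrite leq_add2l; apply/subset_leq_card/fintype.subsetP => w.
  by rewrite finset.in_set in_cyclic_words andbT => /andP[].
Qed.


(** * Counting automorphisms of bounded range *)

Lemma Aut_commute (A : finType) (X : subshift A) (f : Aut X) :
  set_val f \o @subshift_map A X = @subshift_map A X \o set_val f.
Proof. by have [_] := set_valP f. Qed.

Lemma Aut_eq (A : finType) (X : subshift A) (f g : Aut X) :
  (forall x : X, set_val (set_val f x) 0 = set_val (set_val g x) 0) -> f = g.
Proof.
move=> fg; apply/val_inj/funext => x; apply/val_inj/funext => i.
have [y xy] := shifted_exists i x.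
have := fg y; rewrite (shifted_commute (Aut_commute f) xy).
by rewrite (shifted_commute (Aut_commute g) xy) add0r.
Qed.

(** The word of a point [x] at [- n] occurs at some [j] in a covering point [y]. As [2n < N], [x]
    agrees up to radius [n] with [y] shifted by [j + n], so [g x] at 0 is [g y] at [j + n]. *)
Lemma card_range_le (A : finType) (X : subshift A) N n
    (s : N.-tuple A -> N.-tuple A) (G : {fset Aut X}) :
  successor X s -> (n + n < N)%N -> (forall g, g \in G -> has_range n (set_val g)) ->
  exists M : nat,
    (M + complexity X N <= complexity X N.+1 + #|word_cycles X s|)%N /\
    (#|` G| <= complexity X (complexity X N).+1 ^ M)%N.
Proof.
move=> sP nN Gn; have [ys [ysM ysL]] := language_cover sP.
exists (size ys); split=> //; set v := complexity X N.
(* The positions [j + n] with [0 <= j <= v] form a window of length [v.+1] starting at [n]. *)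
pose code (g : Aut X) : {ffun 'I_(size ys) -> v.+1.-tuple A} :=
  [ffun k => word (set_val g (tnth (in_tuple ys) k)) n v.+1].
have code_inj : {in G &, injective code}.
  move=> f g fG gG fg; apply: Aut_eq => x.
  have [y yys [j jv xy]] := ysL _ (word_language x (- n%:Z) N).
  have [z yz] := shifted_exists (j%:Z + n%:Z) y.
  have xz : agree n (set_val x) (set_val z).
    move=> i ile; have /word_eqP/(_ `|(i + n%:Z)%R|%N) := xy.
    have -> : - n%:Z + `|(i + n%:Z)%R|%N%:Z = i by lia.
    by rewrite yz => ->; [congr (set_val y _); lia | lia].
  rewrite (Gn f fG _ _ xz) (Gn g gG _ _ xz).
  rewrite (shifted_commute (Aut_commute f) yz) (shifted_commute (Aut_commute g) yz).
  have [k ky] : exists k, tnth (in_tuple ys) k = y.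
    by have /tnthP[k ->] : y \in in_tuple ys by []; exists k.
  have /word_eqP/(_ j jv) : word (set_val f y) n v.+1 = word (set_val g y) n v.+1.
    by have := congr1 (fun c : {ffun _} => c k) fg; rewrite !ffunE ky.
  by rewrite !add0r addrC.
suff : (size (map code G) <= #|ffun_on (language_n X v.+1) : pred {ffun 'I_(size ys) -> _}|)%N.
  by rewrite card_ffun_on card_ord size_map.
rewrite cardE.
apply: uniq_leq_size; first by rewrite map_inj_in_uniq// fset_uniq.
move=> _ /mapP[g gG ->]; rewrite mem_enum; apply/ffun_onP => k.
by rewrite ffunE; exact: word_language.
Qed.

Lemma has_range_comp (A : finType) (X : subshift A) m n (f g : X -> X) :
  g \o @subshift_map A X = @subshift_map A X \o g ->
  has_range m f -> has_range n g -> has_range (m + n) (f \o g).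
Proof.
move=> gS fm gn x y xy; apply: fm => i im.
have [x' xx'] := shifted_exists i x; have [y' yy'] := shifted_exists i y.
have := gn x' y'; rewrite !(shifted_commute gS xx') !(shifted_commute gS yy') add0r.
by apply=> j jn; rewrite xx' yy'; apply: xy; lia.
Qed.

Lemma has_range_le (A : finType) (X : subshift A) m n (f : X -> X) :
  (m <= n)%N -> has_range m f -> has_range n f.
Proof. by move=> mn fm x y xy; apply: fm => i im; apply: xy; lia. Qed.

Lemma Aut_has_range (A : finType) (X : subshift A) (f : Aut X) :
  exists n, has_range n (set_val f).
Proof. by have [[fc _] _] := set_valP f; exact: continuous_has_range. Qed.

Lemma Aut_countable (A : finType) (X : subshift A) : countable [set: Aut X].
Proof.
have -> : [set: Aut X] = \bigcup_n [set f : Aut X | has_range n (set_val f)].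
  by apply/seteqP; split=> // f _; have [n fn] := Aut_has_range f; exists n.
apply: bigcup_countable => // n _.
(* [option A] is inhabited even when [A] is empty; on words outside the language any value is
   allowed. *)
pose at_center (f : Aut X) (w : (n + n).+1.-tuple A) (a : option A) :=
  forall x : X, w = word x (- n%:Z) (n + n).+1 -> a = Some (set_val (set_val f x) 0).
pose rule (f : Aut X) : {ffun (n + n).+1.-tuple A -> option A} :=
  [ffun w => get (at_center f w)].
have ruleP (f : Aut X) w : has_range n (set_val f) -> at_center f w (rule f w).
  move=> fn; rewrite ffunE; apply: (@getPex _ (at_center f w)).
  have [[x wx]|nox] := pselect (exists x : X, w = word x (- n%:Z) (n + n).+1).
    exists (Some (set_val (set_val f x) 0)) => y; rewrite wx => /word_eqP xy.
    congr Some; apply: fn => i ile; have := xy `|(i + n%:Z)%R|%N.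
    by have -> : - n%:Z + `|(i + n%:Z)%R|%N%:Z = i by [lia]; apply; lia.
  by exists None => x wx; case: nox; exists x.
have inj : {in [set f : Aut X | has_range n (set_val f)] &, injective rule}.
  move=> f g; rewrite !inE /= => fn gn fg; apply: Aut_eq => x.
  apply: Some_inj; rewrite -(ruleP f _ fn x erefl) fg; exact: ruleP.
by rewrite -(eq_countable (inj_card_eq inj)); exact: countableP.
Qed.


(** * Growth estimates in natural numbers *)

Lemma exists_small_increment (f : nat -> nat) a m : (0 < m)%N ->
  exists i, (i < m /\ m * f (a + i).+1 <= m * f (a + i) + f (a + m))%N.
Proof.
move=> m0; apply: contrapT => /forallNP noi.
(* If all [m] increments exceeded the average [f (a + m) / m], their sum would exceed
   [f (a + m)]. *)
have large i : (i <= m)%N -> (i * (f (a + m)).+1 <= m * f (a + i))%N.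
  elim: i => [|i IHi] im; first by rewrite mul0n.
  have /not_andP[/negP|/negP] := noi i; first by rewrite im.
  by rewrite -ltnNge addnS => ?; have := IHi (ltnW im); lia.
by have := large m (leqnn m); rewrite leq_pmul2l// ltnn.
Qed.

Lemma leq_mul_exp2 m j : (4 <= j)%N -> (m <= j)%N -> (m * j <= 2 ^ j)%N.
Proof.
move=> j4 mj; apply: leq_trans (_ : j * j <= _)%N; first by rewrite leq_mul2r mj orbT.
elim: j j4 {mj} => // j IHj; rewrite leq_eqVlt => /predU1P[[<-]//|j4].
by rewrite expnS; have := IHj j4; nia.
Qed.

(** Step [j] adds at most [a j.+2 / 2 ^ j <= 16 * 2 ^ j / (k * j.+2)]. These terms grow almost
    geometrically, so their sum is comparable to the last one. *)
Lemma dyadic_recurrence (a K : nat -> nat) k C j0 J : (2 <= j0)%N ->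
  (forall j, j0 <= j -> k * j * a j <= 4 ^ j)%N -> (K j0 <= C)%N ->
  (forall j, j.+2 <= J -> 2 ^ j * K j.+1 <= 2 ^ j * K j + a j.+2)%N ->
  forall j, (j0 <= j -> j.+1 <= J -> j * (k * K j) <= j * (k * C) + 64 * 2 ^ j)%N.
Proof.
move=> j02 ka KC Krec; elim=> [|j IHj]; first by rewrite leqn0 => /eqP j00; lia.
rewrite leq_eqVlt => /predU1P[<- _|jj jJ].
  by rewrite (leq_trans _ (leq_addr _ _))// !leq_mul2l KC !orbT.
have {}IHj := IHj jj (ltnW jJ).
have := Krec j jJ; have := ka j.+2 ltac:(lia).
rewrite (_ : 4 ^ j.+2 = 16 * (2 ^ j * 2 ^ j))%N; last first.
  by rewrite -expnMn !expnS mulnA.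
rewrite [(2 ^ j.+1)%N]expnS.
have : (0 < 2 ^ j)%N by rewrite expn_gt0.
move: (2 ^ j)%N (K j) (K j.+1) (a j.+2) IHj => q x x' a' IH q0 ka' Kx.
have j2 : (2 <= j)%N by lia.
have step : (j.+2 * (k * x') <= j.+2 * (k * x) + 16 * q)%N.
  rewrite -(leq_pmul2l q0).
  have := leq_mul (leqnn (k * j.+2)) Kx; lia.
(* The constant 64 reproduces itself because [64(j+1)(j+2) + 16j(j+1) <= 128j(j+2)] for [j >= 2]. *)
have main : (j * j.+2 * (j.+1 * (k * x')) <=
             j * j.+2 * (j.+1 * (k * C) + 64 * (2 * q)))%N.
  have := leq_mul (leqnn (j * j.+1)) step.
  have := leq_mul (leqnn (j.+1 * j.+2)) IH.
  have : (64 * (j.+1 * j.+2) + 16 * (j * j.+1) <= 128 * (j * j.+2))%N by nia.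
  move=> /(leq_mul (leqnn q)). lia.
by rewrite leq_pmul2l// in main; lia.
Qed.

(** The growth hypothesis at [n = 2 ^ j], where [log n] is proportional to [j], cleared of
    denominators. *)
Definition slow_growth (A : finType) (X : subshift A) : Prop :=
  forall k, exists j0, forall j,
    (j0 <= j -> k * j * complexity X (2 ^ j) <= 4 ^ j)%N.

Lemma card_range_subexponential (A : finType) (X : subshift A) D i :
  slow_growth X -> (0 < D)%N -> exists2 J, (i <= J)%N &
  forall n (G : {fset Aut X}), (n + n < 2 ^ J)%N ->
    (forall g, g \in G -> has_range n (set_val g)) ->
    (#|` G| ^ D <= 2 ^ (2 ^ J))%N.
Proof.
(* [360 = 45 * 8], with 45 from the bound [kM] and 8 from the exponent in [cv]. *)
move=> /(_ (360 * D)%N)[j1 kaj1] D0; set k := (360 * D)%N in kaj1.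
pose a j := complexity X (2 ^ j).
have [j0 [j02 ka]] : exists j0, (2 <= j0)%N /\
    forall j, (j0 <= j -> k * j * a j <= 4 ^ j)%N.
  exists (maxn 2 j1); split; first exact: leq_maxl.
  by move=> j; rewrite geq_max => /andP[_]; exact: kaj1.
(* [C] bounds the number of cycles shorter than [2 ^ j0]; the summand [k * C] of [J] makes its
   contribution at most [2 ^ J]. *)
pose C := a j0.+1; pose J := (i + j0 + 4 + k * C)%N; exists J; first by rewrite /J; lia.
move=> n G nJ Gn.
have [l [lJ cN]] := exists_small_increment (complexity X) (2 ^ J) (m := 2 ^ J)
  ltac:(by rewrite expn_gt0).
set N := (2 ^ J + l)%N in cN.
have JN : (2 ^ J <= N)%N by exact: leq_addr.
have NJ : (N <= 2 ^ J.+1)%N by rewrite expnS mul2n -addnn leq_add2l ltnW.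
rewrite addnn -mul2n -expnS -/(a J.+1) in cN.
have [s sP] := successor_exists X N.
have [M [MW GM]] := card_range_le sP (leq_trans nJ JN) Gn.
pose K j := #|[set B in word_cycles X s | #|B| < 2 ^ j]|%N.
have leN j : (j <= J)%N -> (2 ^ j <= N)%N.
  by move=> jJ; apply: leq_trans JN; rewrite leq_exp2l.
have K0 : (K j0 <= C)%N by have [+ _ _] := word_cycles_dyadic j0 sP; apply; apply: leN; rewrite /J; lia.
have Krec j : (j.+2 <= J -> 2 ^ j * K j.+1 <= 2 ^ j * K j + a j.+2)%N.
  by move=> jJ; have [_ + _] := word_cycles_dyadic j sP; apply; exact: leN.
have kK := dyadic_recurrence j02 ka K0 Krec (j := J.-1) ltac:(rewrite /J; lia)
  ltac:(rewrite /J; lia).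
have [_ _ W] := word_cycles_dyadic J.-1 sP.
rewrite -/(K _) in W.
have caN : (complexity X N <= a J.+1)%N by exact: leq_complexity.
have kC : (J * (k * C) <= 2 ^ J)%N.
  by rewrite mulnC leq_mul_exp2// /J; lia.
have kaJ := ka J.+1 ltac:(rewrite /J; lia).
have J8 : (6 <= J)%N by rewrite /J; lia.
have qJ : (2 ^ J = 2 * 2 ^ J.-1)%N by rewrite -expnS prednK//; lia.
have qJ1 : (4 ^ J.+1 = 4 * (2 ^ J * 2 ^ J))%N by rewrite expnS -expnMn.
have q0 : (0 < 2 ^ J)%N by rewrite expn_gt0.
(* The term in [C] contributes 1, the dyadic sum 64 / 2 = 32, and three copies of [a J.+1], one from
   the increment and two from the long cycles, 3 * 4 = 12. *)
have kM : (J.-1 * (k * M) <= 45 * 2 ^ J)%N.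
  rewrite qJ1 in kaJ.
  move: (2 ^ J)%N (2 ^ J.-1)%N (K J.-1) qJ q0 kK kC kaJ cN W caN MW
    => q h x qh q0 kK kC kaJ cN W caN MW.
  have qM : (q * M <= q * x + 3 * a J.+1)%N.
    by have := leq_mul (leqnn q) MW; lia.
  have qkM : (q * (J.-1 * (k * M)) <= q * (45 * q))%N.
    have := leq_mul (leqnn (k * J.-1)) qM.
    have : (k * J.-1 * a J.+1 <= k * J.+1 * a J.+1)%N.
      by rewrite !leq_mul//; lia.
    have := leq_mul (leqnn q) kK.
    have : (J.-1 * (k * C) <= q)%N by apply: leq_trans kC; rewrite leq_mul2r leq_pred orbT.
    move=> /(leq_mul (leqnn q)); lia.
  by rewrite leq_pmul2l in qkM.
have vJ : ((complexity X N).+1 <= 2 ^ (2 * J.+1))%N.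
  rewrite expnM -[(2 ^ 2)%N]/4%N.
  suff : (a J.+1 < 4 ^ J.+1)%N by apply: leq_ltn_trans.
  have : (0 < 4 ^ J.+1)%N by rewrite expn_gt0.
  have /leq_mul/(_ (leqnn (a J.+1))) : (2 <= k * J.+1)%N by rewrite /k; nia.
  by move: kaJ; lia.
(* The bound is [4^(2(J+1)) = 2^(4(J+1))], and [4(J+1) <= 8(J-1)] for [J >= 3]. *)
have cv : (complexity X (complexity X N).+1 <= 2 ^ (8 * J.-1))%N.
  apply: leq_trans (leq_complexity _ vJ) _.
  rewrite -/(a _).
  have ka2 := ka (2 * J.+1)%N ltac:(rewrite /J; lia).
  apply: (@leq_trans (4 ^ (2 * J.+1))).
    by apply: leq_trans ka2; rewrite leq_pmull// /k; nia.
  by rewrite -[4%N]/(2 ^ 2)%N -expnM leq_exp2l//; lia.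
apply: (@leq_trans ((complexity X (complexity X N).+1 ^ M) ^ D)).
  by rewrite leq_exp2r.
apply: (@leq_trans (((2 ^ (8 * J.-1)) ^ M) ^ D)).
  rewrite leq_exp2r//; have [->//|M0] := posnP M; by rewrite leq_exp2r.
rewrite -!expnM leq_exp2l//.
rewrite -(@leq_pmul2l 45)//; move: kM; rewrite /k; lia.
Qed.


(** * The limit hypothesis and amenability *)

Lemma complexity_slow_growth (R : realType) (A : finType) (X : subshift A) :
  ((complexity X n)%:R / (n%:R ^+ 2 * (ln n%:R)^-1) : R) @[n --> \oo] --> (0 : R) ->
  slow_growth X.
Proof.
move=> hX k; have ln2 : 0 < ln (2 : R) by rewrite ln_gt0// ltr1n.
(* At [n = 2 ^ j] the ratio is [c(2^j) j ln 2 / 4^j]; this bound on it cancels [ln 2] and leaves the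
   factor [k.+1]. *)
have e0 : 0 < ln (2 : R) / k.+1%:R by rewrite divr_gt0.
have /cvgr0Pnorm_lt/(_ _ e0)[N _ Nu] := hX.
exists N.+1 => j Nj; have j0 : (0 < j)%N by exact: leq_ltn_trans Nj.
have := Nu (2 ^ j)%N; rewrite /= => /(_ (leq_trans (ltnW Nj) (ltnW (ltn_expl j _)))).
move=> /(_ isT); set c := complexity X _.
have -> : c%:R / ((2 ^ j)%:R ^+ 2 * (ln (2 ^ j)%:R)^-1) =
    c%:R * j%:R * ln 2 / 4 ^+ j :> R.
  rewrite natrX lnXn// -mulr_natl invfM invrK -exprM mulnC exprM expr2.
  by rewrite (_ : 2 * 2 = 4 :> R); [ring | lra].
have p0 : 0 < 4 ^+ j :> R by rewrite exprn_gt0.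
rewrite ger0_norm; last first.
  by rewrite divr_ge0 ?(ltW p0)// mulr_ge0// ltW.
rewrite ltr_pdivrMr// [ltRHS]mulrAC ltr_pdivlMr// => cj.
have {}cj : (c%:R * j%:R) * k.+1%:R < 4 ^+ j :> R.
  by rewrite -(ltr_pM2r ln2) mulrAC [ltRHS]mulrC.
rewrite -(@ler_nat R) natrX; apply: le_trans (ltW cj).
by rewrite -!natrM ler_nat; lia.
Qed.

(** Take [F i] invariant up to [1 / i.+1] under the elements with code below [i]: for a fixed
    element the ratios are eventually below the harmonic sequence. *)
Lemma amenable_criterion (R : realType) (G : groupType) : countable [set: G] ->
  (forall (S : {fset G}) (h : nat), exists2 F : {fset G}, F != fset0 &
    forall g, g \in S ->
      (h * #|` fset_symdiff F [fset (g * x)%g | x in F]%fset| <= #|` F|)%N) ->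
  amenable R G.
Proof.
move=> /countable_injP[code code_inj] folner.
pose decode (n : nat) : G := xget 1%g [set g | code g = n].
have codeK g : decode (code g) = g.
  by apply: code_inj; rewrite ?inE//; apply: (xgetPex 1%g (P := [set g' | code g' = code g])); exists g.
have /choice[F FP] : forall i, exists F : {fset G}, F != fset0 /\
    forall n, (n < i)%N ->
      (i.+1 * #|` fset_symdiff F [fset (decode n * x)%g | x in F]%fset| <= #|` F|)%N.
  move=> i; have [F F0 Fi] := folner [fset decode n | n in iota 0 i]%fset i.+1.
  exists F; split=> // n ni; apply: Fi; apply/imfsetP; exists n => //=.
  by rewrite mem_iota.
exists F; split=> [i|g]; first by have [] := FP i.
apply: (squeeze_cvgr _ (cvg_cst 0) cvg_harmonic).
exists (code g).+1 => // i /= gi; have [F0 Fi] := FP i.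
have {F0} F0 : (0 < #|` F i|)%N by rewrite cardfs_gt0.
rewrite divr_ge0//= /harmonic ler_pdivrMr ?ltr0n// mulrC ler_pdivlMr ?ltr0n//.
by rewrite -natrM ler_nat mulnC; have := Fi (code g) gi; rewrite codeK.
Qed.

(** Balls of the submonoid generated by [S]; inverses are not adjoined, since only translations by
    [S] have to be controlled. *)
Fixpoint fset_ball (G : groupType) (S : {fset G}) (m : nat) : {fset G} :=
  if m is m'.+1 then
    (fset_ball S m' `|` [fset (s * b)%g | s in S, b in fset_ball S m'])%fset
  else [fset 1%g]%fset.

(** The ball and its translate have equal size and both lie in the next ball, so their symmetric
    difference is twice the excess of their union. *)
Lemma fset_symdiff_ball (G : groupType) (S : {fset G}) m (g : G) : g \in S ->
  (#|` fset_symdiff (fset_ball S m) [fset (g * x)%g | x in fset_ball S m]%fset|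
     + 2 * #|` fset_ball S m| <= 2 * #|` fset_ball S m.+1|)%N.
Proof.
move=> gS; set B := fset_ball S m; set U := fset_ball S m.+1.
set gB := [fset (g * x)%g | x in B]%fset.
have BU : (B `<=` U)%fset by exact: fsubsetUl.
have gBU : (gB `<=` U)%fset.
  apply/fsubsetP => _ /imfsetP[x /= xB ->]; rewrite in_fsetU; apply/orP; right.
  by apply/imfset2P; exists g => //; exists x.
have gB_card : #|` gB| = #|` B| by apply: card_imfset; exact: mulgI.
have : (#|` fset_symdiff B gB| <= #|` (B `\` gB)%fset| + #|` (gB `\` B)%fset|)%N.
  by rewrite /fset_symdiff -cardfsUI leq_addr.
have := cardfsID gB B; have := cardfsID B gB.
have := fsubset_leq_card (_ : (B `|` gB `<=` U)%fset).
rewrite fsubUset BU gBU => /(_ isT); have := cardfsUI B gB.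
by rewrite (fsetIC gB B); lia.
Qed.

Lemma leq_mul2_expn_succ h : (0 < h -> 2 * h ^ h <= h.+1 ^ h)%N.
Proof.
move=> h0; have bernoulli n : ((h + n) * h ^ n <= h * h.+1 ^ n)%N.
  elim: n => [|n IHn]; first by rewrite addn0.
  by have := leq_mul (leqnn h.+1) IHn; rewrite !expnS; nia.
by have := bernoulli h; rewrite addnn -mul2n -mulnA mulnCA leq_pmul2l.
Qed.

Lemma ball_folner (G : groupType) (S : {fset G}) m h (B := fset_ball S) (g : G) :
  (h.*2.+1 * #|` B m.+1| <= h.*2.+2 * #|` B m|)%N -> g \in S ->
  (h * #|` fset_symdiff (B m) [fset (g * x)%g | x in B m]%fset| <= #|` B m|)%N.
Proof.
by move=> Bm /(fset_symdiff_ball m) /(leq_mul (leqnn h.*2.+1)); rewrite -/B; lia.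
Qed.

Lemma fset_ball_gt0 (G : groupType) (S : {fset G}) m : (0 < #|` fset_ball S m|)%N.
Proof.
rewrite cardfs_gt0; apply/fset0Pn; exists 1%g.
by elim: m => [|m IHm]; [rewrite in_fset1 | rewrite in_fsetU IHm].
Qed.

(** Otherwise the balls grow like [(1 + 1/H)^m]; but the ball of radius [m] has range [m * r], which
    contradicts [card_range_subexponential]. *)
Lemma Aut_ball_growth (A : finType) (X : subshift A) (S : {fset Aut X}) (h : nat)
    (B := fset_ball S) :
  slow_growth X -> exists m, (h.*2.+1 * #|` B m.+1| <= h.*2.+2 * #|` B m|)%N.
Proof.
move=> slow; have B0 m : (0 < #|` B m|)%N by exact: fset_ball_gt0.
apply: contrapT => /forallNP noB; set H := h.*2.+1 in noB.
have grow m : (H.+1 ^ m <= H ^ m * #|` B m|)%N.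
  elim: m => [|m IHm]; first by rewrite mul1n; exact: B0.
  have /negP := noB m; rewrite -ltnNge => /ltnW.
  move=> /(leq_mul (leqnn (H ^ m))); rewrite !expnS.
  by have := leq_mul (leqnn H.+1) IHm; lia.
have [r Sr] : exists r, forall g, g \in S -> has_range r (set_val g).
  have /choice[r rP] := @Aut_has_range A X.
  exists (\max_(g <- S) r g)%N => g gS; apply: has_range_le (rP g).
  exact: leq_bigmax_seq.
have Br m g : g \in B m -> has_range (m * r) (set_val g).
  elim: m g => [|m IHm] g.
    by rewrite in_fset1 => /eqP -> x y; apply.
  rewrite in_fsetU => /orP[/IHm|/imfset2P[s sS [b bB ->]]].
    by apply: has_range_le; rewrite leq_mul2r leqnSn orbT.
  by rewrite mulSn; apply: has_range_comp; [exact: Aut_commute|exact: Sr|exact: IHm].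
(* As [2r < 2^t], the range [m * r] with [m = 2^(J-t)] satisfies [2mr < 2^J]. By [(1 + 1/H)^H >= 2],
   the factor [D] gives [(1 + 1/H)^(mD) >= 2^(m(2^t+1)) > 2^(2^J)]. *)
pose t := (r + r)%N; pose D := (H * (2 ^ t).+1)%N.
have [J tJ BJ] := @card_range_subexponential A X D t slow ltac:(by rewrite muln_gt0).
pose m := (2 ^ (J - t))%N.
have mt : (2 ^ J = m * 2 ^ t)%N by rewrite -expnD subnK.
have m0 : (0 < m)%N by rewrite expn_gt0.
have := BJ (m * r)%N (B m); rewrite mt -mulnDr ltn_pmul2l// ltn_expl//.
move=> /(_ isT (@Br m)) /(leq_mul (leqnn ((H ^ m) ^ D))).
rewrite -expnMn => /(leq_trans _).
have grow' : ((H.+1 ^ m) ^ D <= (H ^ m * #|` B m|) ^ D)%N by rewrite leq_exp2r// muln_gt0.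
move=> /(_ _ grow').
apply/negP; rewrite -ltnNge.
have := leq_mul2_expn_succ (ltn0Sn _ : 0 < H)%N.
set e := (m * (2 ^ t).+1)%N.
have eD : (m * D = H * e)%N by rewrite /e /D; lia.
have e0 : (0 < e)%N by rewrite muln_gt0 m0.
rewrite -(leq_exp2r _ _ e0) expnMn -!expnM eD mulnC => /(leq_trans _); apply.
by rewrite ltn_pmul2l ?expn_gt0// ltn_exp2l// /e mulnS; lia.
Qed.

Theorem theorem1p4 (R : realType) (A : finType) (X : subshift A)
  (hX : ((complexity X n)%:R / (n%:R ^+ 2 * (ln n%:R)^-1) : R)
          @[n --> \oo] --> (0 : R)) :
  countable [set: Aut X] /\ amenable R (Aut X).
Proof.
split; first exact: Aut_countable.
apply: amenable_criterion; first exact: Aut_countable.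
move=> S h; have [m Bm] := Aut_ball_growth S h (complexity_slow_growth hX).
exists (fset_ball S m); first by rewrite -cardfs_gt0 fset_ball_gt0.
by move=> g; exact: ball_folner.
Qed.
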